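(* Let $i,j\in\{0,\dots,n_{ini}-1\}$ with $j<i$, and suppose that $N_{c_{ini}^i}(x_0,t')\le N_{c_{ini}^j}(x_0,t')$ for some time $t'\ge\frac{x_i-x_0}{w}$. Then $$\forall t\ge t',\qquad N_{c_{ini}^i}(x_0,t)\le N_{c_{ini}^j}(x_0,t).$$
   Context: Fundamental diagram: $Q:[0,k_{jam}]\to[0,\infty)$ is a concave function with $Q(0)=Q(k_{jam})=0$. The free-flow speed is $v_f=Q'(0^+)>0$ and the congested wave speed is $w>0$ with $-w=Q'(k_{jam}^-)$ (both finite). The convex transform of $Q$ is $R(u)=\sup_{k\in[0,k_{jam}]}(Q(k)-uk)$ for $u\in[-w,v_f]$. The road link is the interval $[x_0,x_{n_{ini}}]$ with $x_0<x_1<\dots<x_{n_{ini}}$. For $i\in\{0,\dots,n_{ini}-1\}$ the $i$-th initial condition block, imposed at time $0$, is $c_{ini}^i(x)=-k_ix+b_i$ for $x_i\le x\le x_{i+1}$ and $+\infty$ otherwise. The blocks satisfy $0\le k_i\le k_{jam}$ and are continuous at their common endpoints: $c_{ini}^{i}(x_{i+1})=c_{ini}^{i+1}(x_{i+1})$. The solution component $N_{c_{ini}^i}$ associated with block $i$ is given by the Lax-Hopf formula: for $x\in[x_0,x_{n_{ini}}]$ and $t>0$, $$N_{c_{ini}^i}(x,t)=\inf\{c_{ini}^i(y)+t\,R(\tfrac{x-y}{t}) : y\in[x_i,x_{i+1}],\ -w\le \tfrac{x-y}{t}\le v_f\},$$ with $N_{c_{ini}^i}(x,0)=c_{ini}^i(x)$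 and the infimum over the empty set equal to $+\infty$. *)

(* Defs.v *)
From HB Require Import structures.
From mathcomp Require Import all_boot all_order all_algebra.
From mathcomp Require Import all_classical all_reals all_analysis.

Set Implicit Arguments.
Unset Strict Implicit.
Unset Printing Implicit Defensive.

Import Order.TTheory GRing.Theory Num.Theory.
Import numFieldNormedType.Exports.

Local Open Scope classical_set_scope.
Local Open Scope ring_scope.

(* Q is a total function, but only its values on [0, kjam] matter; both
   derivatives are one-sided limits of difference quotients, from inside that
   interval. *)
Record fundamental_diagram (R : realType) (kjam vf w : R) (Q : R -> R) : Prop :=
  FundamentalDiagram {
    kjam_gt0 : 0 < kjam;
    Q_ge0 : forall k, 0 <= k <= kjam -> 0 <= Q k;
    Q_concave :
      convex_function (`[0, kjam]%classic : set R) (fun k : R => - Q k);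
    Q_at0 : Q 0 = 0;
    Q_atkjam : Q kjam = 0;
    vf_gt0 : 0 < vf;
    w_gt0 : 0 < w;
    Q_derive0 : (Q h - Q 0) / h @[h --> 0^'+] --> vf;
    Q_derivekjam : (Q (kjam + h) - Q kjam) / h @[h --> 0^'-] --> - w
  }.

(* Q is nonnegative and lies below its tangent k |-> vf * k at 0, so this real
   supremum is over a nonempty bounded set and never takes its junk value. *)
Definition convex_transform (R : realType) (kjam : R) (Q : R -> R) (u : R) : R :=
  sup [set Q k - u * k | k in `[0, kjam]%classic].

Definition c_ini (R : realType) (x k b : nat -> R) (i : nat) (y : R) : \bar R :=
  if x i <= y <= x i.+1 then (- k i * y + b i)%:E else +oo%E.

(* Only the entries x 0, ..., x n and k i, b i with i < n are constrained. *)
Record initial_blocks (R : realType) (kjam : R) (n : nat) (x k b : nat -> R) :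
    Prop := InitialBlocks {
  x_increasing : forall i, (i < n)%N -> x i < x i.+1;
  k_bounds : forall i, (i < n)%N -> 0 <= k i <= kjam;
  blocks_continuous : forall i, (i.+1 < n)%N ->
    c_ini x k b i (x i.+1) = c_ini x k b i.+1 (x i.+1)
}.

(* Meaningful for y in [x 0, x n] and t >= 0. *)
Definition N_ini (R : realType) (kjam vf w : R) (Q : R -> R) (x k b : nat -> R)
    (i : nat) (y t : R) : \bar R :=
  if t == 0 then c_ini x k b i y
  else ereal_inf
    [set (c_ini x k b i z + (t * convex_transform kjam Q ((y - z) / t))%:E)%E
      | z in [set z | x i <= z <= x i.+1 /\ - w <= (y - z) / t <= vf]].

(* Main.v *)
Require Import Defs.
From mathcomp Require Import all_boot all_order all_algebra.
From mathcomp Require Import all_classical all_reals all_analysis.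
From mathcomp Require Import ring lra.
Import Order.TTheory GRing.Theory Num.Theory.
Local Open Scope ring_scope.

(** The theorem holds because characteristics aimed at the upstream end of the
    link cross.  Write [d = z - x 0] for the distance from the end of the link to
    a point [z] of a block.  Then [t * R((x 0 - z) / t)] equals
    [action t d = sup_k (t * Q k + k * d)], the cost of the straight path that
    starts at distance [d] at time [0] and reaches the end at time [t].  As a
    supremum of linear forms in [(t, d)] it is sublinear ([action_sublinear]),
    so a broken path costs at least as much as the straight path with the same
    ends.

    Take [t' <= t] and starting points at distances [d_j <= d_i].  The path from
    [d_i] arriving at [t'] starts farther and arrives earlier than the path
    from [d_j] arriving at [t], so the two meet; exchanging their tails at the
    meeting point gives broken paths from [d_i] to [t] and from [d_j] to [t'].
    Hence [action_exchange]:
      [action t d_i + action t' d_j <= action t' d_i + action t d_j].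
    Adding the initial costs of the two starting points, any start in block [j]
    feasible at time [t] yields, up to an arbitrarily small error, a start
    in block [i] that is at least as good, because block [i] already beats
    block [j] at time [t'].  The speed limits do not interfere: a start in
    block [i] feasible at [t'] stays feasible later, and since
    [t' >= (x i - x 0) / w] every start in block [j] is feasible at [t']. *)

(** Keeps the supremum in [convex_transform] bounded.  Averaging [k] with its
    mirror image [kjam - k] gives [Q k + Q (kjam - k) <= 2 * Q (kjam / 2)], and
    the second term is nonnegative. *)
Lemma fundamental_diagram_le {R : realType} {kjam vf w : R} {Q : R -> R}
    (hQ : fundamental_diagram kjam vf w Q) {k : R} :
  0 <= k <= kjam -> Q k <= 2 * Q (kjam / 2).
Proof.
move=> hk.
have hk' : 0 <= kjam - k <= kjam by lra.
have half_ge0 : 0 <= 2^-1 :> R by lra.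
have half_le1 : 2^-1 <= 1 :> R by lra.
have : - Q (2^-1 * k + (1 - 2^-1) * (kjam - k))
    <= 2^-1 * - Q k + (1 - 2^-1) * - Q (kjam - k).
  by apply: (Q_concave hQ (Itv01 half_ge0 half_le1)); rewrite inE /= in_itv.
have -> : 2^-1 * k + (1 - 2^-1) * (kjam - k) = kjam / 2 by field.
have := Q_ge0 hQ hk'.
lra.
Qed.

(** For [t > 0] and [d >= 0] this is the supremum of [t * Q k + k * d] over
    [0 <= k <= kjam], a form linear in [(t, d)]. *)
Definition action {R : realType} (kjam : R) (Q : R -> R) (t d : R) : R :=
  t * convex_transform kjam Q (- d / t).

Section Action.
Context {R : realType} {kjam vf w : R} {Q : R -> R}.
Context (hQ : fundamental_diagram kjam vf w Q).

Lemma action_ge {t d k : R} :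
  0 < t -> 0 <= d -> 0 <= k <= kjam -> t * Q k + k * d <= action kjam Q t d.
Proof.
move=> t0 d0 hk.
have -> : t * Q k + k * d = t * (Q k - (- d / t) * k) by field; lra.
rewrite /action ler_pM2l // /convex_transform.
apply: ub_le_sup; last by exists k => //=; rewrite in_itv.
exists (2 * Q (kjam / 2) + d / t * kjam) => _ [l + <-].
rewrite /= in_itv /= => hl.
have Ql := fundamental_diagram_le hQ hl.
have : d / t * l <= d / t * kjam.
  by apply: ler_wpM2l; [apply: divr_ge0 => //; lra | lra].
lra.
Qed.

Lemma action_le {t d M : R} : 0 < t ->
  (forall k, 0 <= k <= kjam -> t * Q k + k * d <= M) -> action kjam Q t d <= M.
Proof.
move=> t0 hM.
rewrite /action mulrC -ler_pdivlMr // /convex_transform.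
apply: ge_sup.
  have k0 := kjam_gt0 hQ.
  by exists (Q 0 - (- d / t) * 0); exists 0 => //=; rewrite in_itv /=; lra.
move=> _ [k + <-]; rewrite /= in_itv /= => hk.
rewrite ler_pdivlMr //.
have -> : (Q k - - d / t * k) * t = t * Q k + k * d by field; lra.
exact: hM.
Qed.

(** A supremum of forms linear in [(t, d)]. *)
Lemma action_sublinear {a1 a2 t1 t2 d1 d2 : R} :
  0 < t1 -> 0 < t2 -> 0 <= d1 -> 0 <= d2 -> 0 <= a1 -> 0 <= a2 ->
  0 < a1 * t1 + a2 * t2 ->
  action kjam Q (a1 * t1 + a2 * t2) (a1 * d1 + a2 * d2)
    <= a1 * action kjam Q t1 d1 + a2 * action kjam Q t2 d2.
Proof.
move=> t10 t20 d10 d20 a10 a20 t0; apply: action_le => // k hk.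
have h1 := ler_wpM2l a10 (action_ge t10 d10 hk).
have h2 := ler_wpM2l a20 (action_ge t20 d20 hk).
lra.
Qed.

(** Two straight paths that cross can exchange their tails: the path from
    distance [d2] arriving at [t1] and the path from [d1] arriving at [t2] are
    replaced by broken paths from [d2] to [t2] and from [d1] to [t1], which are
    no cheaper than the straight ones. *)
Lemma action_exchange {t1 t2 d1 d2 : R} :
  0 < t1 -> t1 <= t2 -> 0 <= d1 -> d1 <= d2 ->
  action kjam Q t2 d2 + action kjam Q t1 d1
    <= action kjam Q t1 d2 + action kjam Q t2 d1.
Proof.
move=> t10 t12 d10 d12.
have [d12e|d12ne] := eqVneq d1 d2; first by rewrite d12e addrC.
have dlt : d1 < d2 by rewrite lt_neqAle d12ne.
have D0 : 0 < t2 * d2 - t1 * d1 by nra.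
(* The fractions of their lengths that the path from d2 and the path from d1
   have covered when they meet; both take the same time, a * t1 = b * t2. *)
pose a := t2 * (d2 - d1) / (t2 * d2 - t1 * d1).
pose b := t1 * (d2 - d1) / (t2 * d2 - t1 * d1).
have a0 : 0 <= a by apply: divr_ge0; nra.
have b0 : 0 <= b by apply: divr_ge0; nra.
have a1 : 0 <= 1 - a by rewrite subr_ge0 ler_pdivrMr // mul1r; nra.
have b1 : 0 <= 1 - b by rewrite subr_ge0 ler_pdivrMr // mul1r; nra.
have Dne : t2 * d2 - t1 * d1 != 0 by rewrite gt_eqF.
have et2 : a * t1 + (1 - b) * t2 = t2 by rewrite /a /b; field.
have ed2 : a * d2 + (1 - b) * d1 = d2 by rewrite /a /b; field.
have et1 : (1 - a) * t1 + b * t2 = t1 by rewrite /a /b; field.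
have ed1 : (1 - a) * d2 + b * d1 = d1 by rewrite /a /b; field.
have t20 : 0 < t2 by lra.
have d20 : 0 <= d2 by lra.
have := action_sublinear t10 t20 d20 d10 a0 b1.
rewrite et2 ed2 => /(_ t20) h2.
have := action_sublinear t10 t20 d20 d10 a1 b0.
rewrite et1 ed1 => /(_ t10) h1.
lra.
Qed.

End Action.

Lemma initial_blocks_le {R : realType} {kjam : R} {n : nat} {x k b : nat -> R}
    (hblocks : initial_blocks kjam n x k b) {i j : nat} :
  (i <= j)%N -> (j <= n)%N -> x i <= x j.
Proof.
elim: j => [|j IH]; first by rewrite leqn0 => /eqP ->.
rewrite leq_eqVlt => /predU1P[-> //|]; rewrite ltnS => ij jn.
exact: le_trans (IH ij (ltnW jn)) (ltW (x_increasing hblocks jn)).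
Qed.

(** At the upstream end only the congested speed [w] limits the starting points:
    reaching the end from downstream means moving at a nonpositive speed. *)
Lemma N_ini_upstreamE (R : realType) (kjam vf w : R) (Q : R -> R)
    (x k b : nat -> R) (i : nat) (t : R) :
  0 < vf -> 0 < t -> x 0%N <= x i ->
  N_ini kjam vf w Q x k b i (x 0%N) t =
  ereal_inf [set (- k i * z + b i + action kjam Q t (z - x 0%N))%:E
            | z in [set z | x i <= z <= x i.+1 /\ z - x 0%N <= w * t]]%classic.
Proof.
move=> vf0 t0 x0i; rewrite /N_ini gt_eqF //; congr ereal_inf.
have cost z : x i <= z <= x i.+1 ->
    (c_ini x k b i z + (t * convex_transform kjam Q ((x 0%N - z) / t))%:E)%E
    = (- k i * z + b i + action kjam Q t (z - x 0%N))%:E.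
  by move=> hz; rewrite /c_ini hz /action opprB EFinD.
have feasible z : x i <= z ->
    (- w <= (x 0%N - z) / t <= vf) = (z - x 0%N <= w * t).
  move=> hz; rewrite ler_pdivlMr // ler_pdivrMr //.
  have vt0 : 0 < vf * t by exact: mulr_gt0.
  by apply/andP/idP => [[? _]|?]; [lra | split; lra].
apply/seteqP; split=> _ [z [hz hs] <-]; exists z; rewrite ?cost //.
- by split=> //; rewrite -feasible //; case/andP: hz.
- by split=> //; rewrite feasible //; case/andP: hz.
Qed.

Theorem theorem4 (R : realType) (kjam vf w : R) (Q : R -> R)
    (hQ : fundamental_diagram kjam vf w Q)
    (n : nat) (x k b : nat -> R)
    (hblocks : initial_blocks kjam n x k b)
    (i j : nat) (hi : (i < n)%N) (hji : (j < i)%N)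
    (t' : R) (ht' : (x i - x 0%N) / w <= t')
    (hle : (N_ini kjam vf w Q x k b i (x 0%N) t'
            <= N_ini kjam vf w Q x k b j (x 0%N) t')%E) :
  forall t : R, t' <= t ->
    (N_ini kjam vf w Q x k b i (x 0%N) t
     <= N_ini kjam vf w Q x k b j (x 0%N) t)%E.
Proof.
move=> t t't.
have vf0 := vf_gt0 hQ; have w0 := w_gt0 hQ.
have x0j : x 0%N <= x j.
  by apply: (initial_blocks_le hblocks) => //; exact: ltnW (ltn_trans hji hi).
have xji : x j.+1 <= x i by apply: (initial_blocks_le hblocks) => //; exact: ltnW.
have xj : x j < x j.+1.
  exact: (x_increasing hblocks (ltn_trans hji hi)).
have x0i : x 0%N <= x i by lra.
have t'0 : 0 < t' by apply: lt_le_trans ht'; apply: divr_gt0 => //; lra.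
have t0 : 0 < t by lra.
have xiw : x i - x 0%N <= w * t' by rewrite mulrC -ler_pdivrMr.
move: hle; rewrite !N_ini_upstreamE // => hle.
apply: le_ereal_inf_tmp => _ [zj [hzj _] <-].
apply/lee_addgt0Pr => e e0.
(* zj is feasible at t' and block i wins there, so some zi is at worst e more
   expensive than zj at t'; the exchange carries this over to t. *)
have hlt : (ereal_inf
    [set (- k i * z + b i + action kjam Q t' (z - x 0%N))%:E
    | z in [set z | x i <= z <= x i.+1 /\ z - x 0%N <= w * t']%R]%classic
    < (- k j * zj + b j + action kjam Q t' (zj - x 0%N) + e)%:E)%E.
  apply: (le_lt_trans hle); apply: (@le_lt_trans _ _
    (- k j * zj + b j + action kjam Q t' (zj - x 0%N))%:E); last first.
    by rewrite lte_fin; lra.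
  by apply: ereal_inf_lbound; exists zj => //; split=> //; lra.
have [_ [zi [hzi hsi] <-]] := ereal_inf_lt hlt.
rewrite lte_fin => hzij.
apply: (@le_trans _ _ (- k i * zi + b i + action kjam Q t (zi - x 0%N))%:E).
  apply: ereal_inf_lbound; exists zi => //; split=> //.
  by apply: (le_trans hsi); rewrite ler_pM2l.
have dj0 : 0 <= zj - x 0%N by lra.
have dji : zj - x 0%N <= zi - x 0%N by lra.
have := action_exchange hQ t'0 t't dj0 dji.
rewrite -EFinD lee_fin; lra.
Qed.
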